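(* Let $k$ be a field of characteristic zero, let $\overline{\mathbb{N}}=\mathbb{N}\cup\{-\infty\}$ be the monoid with operation $\max$, let $H=k\overline{\mathbb{N}}$ be its monoid algebra, and let $f\in H^*$. Then $f\in H^\circ$ if and only if $f$ is eventually constant on $\overline{\mathbb{N}}$, i.e. there exists $n_0\in\mathbb{N}$ such that $f(m)=f(m')$ for all $m,m'\in\mathbb{N}$ with $m,m'\geq n_0$.
   Context: $H^*=\mathrm{Hom}_k(H,k)$ is the linear dual of $H$, and $H^\circ=\{f\in H^*\mid f(I)=0\text{ for some ideal } I\subseteq H\text{ with }\dim(H/I)<\infty\}$ is the finite dual. The identity of $(\overline{\mathbb{N}},\max)$ is $-\infty$, and $\overline{\mathbb{N}}$ is a $k$-basis of $H$. *)

(* Defs.v *)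
From HB Require Import structures.
From mathcomp Require Import all_boot all_order all_algebra.
From mathcomp Require Import monalg.

Set Implicit Arguments.
Unset Strict Implicit.
Unset Printing Implicit Defensive.

Import GRing.Theory.
Local Open Scope ring_scope.

(* The monoid (N u {-oo}, max); [None] encodes -oo. *)
Definition nbar : Type := option nat.
HB.instance Definition _ := Choice.on nbar.

Definition nbar_ninfty : nbar := None.
Definition nbar_nat (n : nat) : nbar := Some n.

Definition nbar_max (x y : nbar) : nbar :=
  match x, y with
  | Some m, Some n => Some (maxn m n)
  | Some m, None => Some m
  | None, _ => y
  end.

Fact nbar_maxA : associative nbar_max.
Proof. by move=> [x|] [y|] [z|] //=; rewrite maxnA. Qed.

Fact nbar_max0x : left_id nbar_ninfty nbar_max.
Proof. by case. Qed.

Fact nbar_maxx0 : right_id nbar_ninfty nbar_max.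
Proof. by case. Qed.

(* [monomType] moreover asks that the identity be the only unit. *)
Fact nbar_max_unit (x y : nbar) :
  nbar_max x y = nbar_ninfty -> x = nbar_ninfty /\ y = nbar_ninfty.
Proof. by case: x y => [x|] [y|]. Qed.

Fact nbar_maxC : commutative nbar_max.
Proof. by move=> [x|] [y|] //=; rewrite maxnC. Qed.

HB.instance Definition _ := Choice_isMonomialDef.Build nbar
  nbar_maxA nbar_max0x nbar_maxx0 nbar_max_unit.
HB.instance Definition _ := MonomialDef_isConomialDef.Build nbar nbar_maxC.

(* The ideals of mathcomp's [ring_quotient] are decidable and proper; here
   neither is required. *)
Definition is_ideal (k : fieldType) (A : algType k) (I : A -> Prop) : Prop :=
  [/\ I 0,
      forall x y, I x -> I y -> I (x + y),
      forall a x, I x -> I (a * x)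
    & forall a x, I x -> I (x * a)].

(* dim (A / I) < oo: the classes modulo I of some b_0, ..., b_(n-1) span A / I. *)
Definition finite_codim (k : fieldType) (A : algType k) (I : A -> Prop) : Prop :=
  exists (n : nat) (b : 'I_n -> A),
    forall x : A, exists c : 'I_n -> k, I (x - \sum_(i < n) c i *: b i).

(* [{scalar A}] is the linear dual A^* = Hom_k(A, k). *)
Definition in_finite_dual (k : fieldType) (A : algType k) (f : {scalar A}) : Prop :=
  exists I : A -> Prop,
    [/\ is_ideal I, finite_codim I & forall x, I x -> f x = 0].

(* Main.v *)
Require Import Defs.
From mathcomp Require Import all_boot all_order all_algebra.
From mathcomp Require Import monalg.
From Stdlib Require Import Classical.

Import GRing.Theory.
Local Open Scope ring_scope.

(** Write [e_x] for the basis element [<< x >>], so that [e_x * e_y] is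
    [e_(max x y)].

    If [f] vanishes on an ideal [I] of codimension at most [n], consider the
    differences [d_l = e_l - e_(l+1)].  They are pairwise orthogonal
    idempotents.  Orthogonal idempotents outside [I] have linearly independent
    classes in [A / I], because multiplying a relation by one of them isolates
    its coefficient; so at most [n] of the [d_l] lie outside [I]
    ([card_orthogonal_idempotents]).  For all large [l] we thus have
    [f d_l = 0], that is [f e_l = f e_(l+1)].

    Conversely, if [f] is constant from [n0] on, take for [I] the largest ideal
    inside the kernel of [f], namely the [x] with [f (a * x) = 0] for all [a].
    For [m >= n0], multiplication by any [e_x] sends [e_m - e_n0] either to [0]
    or to a difference of two basis elements of index at least [n0], so that
    [I] contains [e_m - e_n0].  Hence [A / I] is spanned by the classes of
    [e_-oo, e_0, ..., e_n0]. *)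

(** * Ideals of finite codimension *)

Section Ideal.

Variables (k : fieldType) (A : algType k) (I : A -> Prop).
Hypothesis idI : is_ideal I.

Lemma ideal_scale c x : I x -> I (c *: x).
Proof. by case: idI => _ _ IM _ Ix; rewrite -mulr_algl; apply: IM. Qed.

Lemma ideal_sum n (F : 'I_n -> A) :
  (forall i, I (F i)) -> I (\sum_(i < n) F i).
Proof. by case: idI => I0 ID _ _ IF; apply: (big_ind I). Qed.

(** More elements than the dimension of the quotient are dependent modulo the
    ideal: the coefficients form a matrix with more rows than columns, whose
    left kernel is therefore nonzero. *)
Lemma ideal_dependence m n (b : 'I_n -> A) (e : 'I_m -> A) :
    (forall x, exists c : 'I_n -> k, I (x - \sum_(i < n) c i *: b i)) ->
    (n < m)%N ->
  exists2 v : 'I_m -> k, exists j, v j != 0 & I (\sum_(i < m) v i *: e i).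
Proof.
move=> spanb lt_nm.
have [c Ic] := fin_all_exists (fun i => spanb (e i)).
pose C := \matrix_(i < m, j < n) c i j.
have /rowV0Pn[v /sub_kermxP vC0 nz_v]: kermx C != 0.
  rewrite -mxrank_eq0 mxrank_ker subn_eq0 -ltnNge.
  exact: leq_ltn_trans (rank_leq_col C) lt_nm.
exists (v 0); first exact/rV0Pn.
have <-: \sum_i v 0 i *: (e i - \sum_j c i j *: b j) = \sum_i v 0 i *: e i.
  under eq_bigr do rewrite scalerBr scaler_sumr.
  rewrite sumrB exchange_big /= [X in _ - X]big1 ?subr0 // => j _.
  under eq_bigr do rewrite scalerA.
  rewrite -scaler_suml.
  have /matrixP/(_ 0 j) := vC0; rewrite !mxE => vCj.
  by rewrite -[RHS](scale0r (b j)) -[in RHS]vCj; congr (_ *: _);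
    apply: eq_bigr => i _; rewrite mxE.
by apply: ideal_sum => i; apply: ideal_scale.
Qed.

(** A linear relation modulo the ideal, multiplied by the [j]-th idempotent,
    keeps only its [j]-th term. *)
Lemma card_orthogonal_idempotents m n (b : 'I_n -> A) (e : 'I_m -> A) :
    (forall x, exists c : 'I_n -> k, I (x - \sum_(i < n) c i *: b i)) ->
    (forall i j, e i * e j = e i *+ (i == j)) ->
    (forall i, ~ I (e i)) ->
  (m <= n)%N.
Proof.
move=> spanb eM nIe; rewrite leqNgt; apply/negP => lt_nm.
have [v [j nz_vj] Iv] := ideal_dependence _ _ b e spanb lt_nm.
apply: (nIe j); have [_ _ IM _] := idI.
have := ideal_scale (v j)^-1 _ (IM (e j) _ Iv).
rewrite mulr_sumr (bigD1 j) //= big1 => [|i ne_ij].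
  by rewrite addr0 -scalerAr eM eqxx mulr1n scalerA mulVf // scale1r.
by rewrite -scalerAr eM eq_sym (negPf ne_ij) scaler0.
Qed.

End Ideal.

(** * Bounded sets of natural numbers *)

(** An unbounded set would contain arbitrarily long increasing sequences. *)
Lemma bounded_of_size_uniq (P : pred nat) n :
    (forall s, uniq s -> all P s -> (size s <= n)%N) ->
  exists N, forall l, P l -> (l < N)%N.
Proof.
move=> leP; apply: NNPP => unbounded.
have above N : exists2 l, P l & (N <= l)%N.
  apply: NNPP => noN; apply: unbounded; exists N => l Pl.
  by rewrite ltnNge; apply/negP => leNl; apply: noN; exists l.
suff [s [us Ps sz]]: exists s, [/\ uniq s, all P s & size s = n.+1].
  by have := leP s us Ps; rewrite sz ltnn.
elim: n.+1 => [|i [s [us Ps sz]]]; first by exists [::].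
have [l Pl le_l] := above (\max_(x <- s) x).+1.
exists (l :: s); split; rewrite /= ?Pl ?sz // us andbT.
apply/negP => sl; move: le_l; rewrite ltnNge => /negP; apply.
exact: (@leq_bigmax_seq _ s xpredT id l).
Qed.

(** * Monoid algebras *)

Lemma malgU_mul (k : fieldType) (M : monomType) (x y : M) :
  << x >> * << y >> = << mmul x y >> :> {malg k[M]}.
Proof. by rewrite malgM_def fgmulUU mulr1. Qed.

Lemma malg_ind (k : fieldType) (M : monomType) (P : {malg k[M]} -> Prop) :
    P 0 -> (forall c x u, P u -> P (c *: << x >> + u)) ->
  forall u, P u.
Proof.
move=> P0 PD u; rewrite (monalgE u).
elim: (finmap.enum_fset (msupp u)) => [|x s IHs]; first by rewrite big_nil.
rewrite big_cons; suff ->: << u@_x *g x >> = u@_x *: << x >> by apply: PD.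
by apply/malgP => y; rewrite mcoeffZ !mcoeffU mulrnAr mulr1.
Qed.

(** The elements congruent modulo [I] to a combination of [s] form a subspace,
    so it is enough that this subspace contains the basis. *)
Lemma malg_finite_codim (k : fieldType) (M : conomType)
    (I : {malg k[M]} -> Prop) (s : seq {malg k[M]}) :
    is_ideal I -> (forall x : M, exists2 b, b \in s & I (<< x >> - b)) ->
  finite_codim I.
Proof.
move=> idI spans; have [I0 ID _ _] := idI.
exists (size s), (tnth (in_tuple s)); elim/malg_ind => [|c x u [d Id]].
  by exists (fun=> 0); rewrite big1 ?subr0 // => i _; rewrite scale0r.
have [b /(tnthP (in_tuple s))[j ->] Ixb] := spans x.
exists (fun i => c *+ (i == j) + d i).
under eq_bigr do rewrite scalerDl.
rewrite big_split /= (bigD1 j) //= [X in _ - (_ + X + _)]big1 => [|i /negPf->];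
  last by rewrite scale0r.
rewrite eqxx mulr1n addr0 opprD addrACA -scalerBr.
by apply: ID => //; apply: ideal_scale.
Qed.

(** * The monoid algebra of the extended natural numbers *)

Section Nbar.

Variable k : fieldType.
Local Notation H := {malg k[nbar]}.

Lemma nbarU_mul (x y : nbar) : << x >> * << y >> = << nbar_max x y >> :> H.
Proof. exact: malgU_mul. Qed.

Definition gap (l : nat) : H := << nbar_nat l >> - << nbar_nat l.+1 >>.

Lemma gap_orthogonal l m : gap l * gap m = gap l *+ (l == m).
Proof.
wlog le_lm: l m / (l <= m)%N => [IH|].
  have [/IH//|/ltnW/IH] := leqP l m.
  by rewrite mulrC eq_sym => ->; case: eqP => // ->.
rewrite /gap mulrBl !mulrBr !nbarU_mul /nbar_max /nbar_nat.
case: eqP le_lm => [->|/eqP ne_lm] le_lm.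
  by rewrite !maxnn (maxn_idPl (leqnSn m)) (maxn_idPr (leqnSn m)) subrr subr0.
have lt_lm : (l < m)%N by rewrite ltn_neqAle ne_lm.
rewrite (maxn_idPr le_lm) (maxn_idPr (leqW le_lm)) (maxn_idPr lt_lm).
by rewrite (maxn_idPr (leqW lt_lm)) subrr.
Qed.

Lemma eventually_constant_of_finite_dual (f : {scalar H}) :
    in_finite_dual f ->
  exists n0 : nat, forall m m' : nat, (n0 <= m)%N -> (n0 <= m')%N ->
    f << nbar_nat m >> = f << nbar_nat m' >>.
Proof.
case=> I [idI [n [b spanb]] fI0].
have [|N boundN] := bounded_of_size_uniq (fun l => f (gap l) != 0) n.
  move=> s us /allP fs.
  apply: (card_orthogonal_idempotents k H I idI _ _ b (fun i : 'I_(size s) =>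
    gap (nth 0%N s i)) spanb) => [i j|i /fI0/eqP].
    by rewrite gap_orthogonal nth_uniq.
  by apply/negP/fs/mem_nth.
suff constN m : (N <= m)%N -> f << nbar_nat m >> = f << nbar_nat N >>.
  by exists N => m m' /constN-> /constN->.
elim: m => [|m IHm]; first by rewrite leqn0 => /eqP->.
rewrite leq_eqVlt => /predU1P[->//|le_Nm]; rewrite -IHm //.
apply/esym/eqP; rewrite -subr_eq0 -raddfB.
by apply/negPn/negP => /boundN; rewrite ltnNge -ltnS le_Nm.
Qed.

Lemma finite_dual_of_eventually_constant (f : {scalar H}) n0 :
    (forall m m' : nat, (n0 <= m)%N -> (n0 <= m')%N ->
       f << nbar_nat m >> = f << nbar_nat m' >>) ->
  in_finite_dual f.
Proof.
move=> constf; pose I (x : H) := forall a, f (a * x) = 0.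
have idI : is_ideal I.
  split=> [a|x y Ix Iy a|a x Ix c|a x Ix c].
  - by rewrite mulr0 raddf0.
  - by rewrite mulrDr raddfD /= Ix Iy addr0.
  - by rewrite mulrA.
  - by rewrite [x * a]mulrC mulrA.
exists I; split=> // [|x Ix]; last by rewrite -[x]mul1r.
apply: (malg_finite_codim k _ I (<< nbar_ninfty >> ::
  [seq << nbar_nat i >> | i <- iota 0 n0.+1]) idI) => x.
have I0 : I 0 by case: idI.
case: x => [m|]; last by exists << nbar_ninfty >>; rewrite ?mem_head ?subrr.
exists << nbar_nat (minn m n0) >>.
  rewrite inE; apply/orP; right.
  apply: (map_f (fun i => << nbar_nat i >> : H)).
  by rewrite mem_iota add0n ltnS geq_minr.
have [le_mn|/ltnW le_nm] := leqP m n0; first by rewrite subrr.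
elim/malg_ind => [|c x u IHu]; first by rewrite mul0r raddf0.
rewrite mulrDl raddfD /= IHu addr0 -scalerAl linearZ /= mulrBr !nbarU_mul.
rewrite raddfB; case: x => [j|] /=; last first.
  by rewrite (constf m n0) // subrr mulr0.
by rewrite (constf (maxn j m) (maxn j n0)) ?subrr ?mulr0 //
  leq_max ?leqnn ?le_nm orbT.
Qed.

End Nbar.

(* [<< x >>] is the basis element of the monoid algebra attached to [x]. *)
Theorem proposition4p5 (k : fieldType) (char0 : [pchar k] =i pred0)
    (f : {scalar {malg k[nbar]}}) :
  in_finite_dual f <->
  exists n0 : nat, forall m m' : nat, (n0 <= m)%N -> (n0 <= m')%N ->
    f << nbar_nat m >> = f << nbar_nat m' >>.
Proof.
split=> [|[n0]]; first exact: eventually_constant_of_finite_dual.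
exact: finite_dual_of_eventually_constant.
Qed.
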